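(* For every ballean $(X,\mathcal{E})$, the free vector ballean $\mathbb{V}(X,\mathcal{E})$ is normal if and only if $\mathbb{V}(X,\mathcal{E})$ is metrizable.
   Context: A coarse structure on a set $X$ is a family $\mathcal{E}$ of subsets of $X\times X$ such that: each $\varepsilon\in\mathcal{E}$ contains the diagonal $\Delta_X=\{(x,x):x\in X\}$; if $\varepsilon,\delta\in\mathcal{E}$ then $\varepsilon\circ\delta=\{(x,y):\exists z\,((x,z)\in\varepsilon,\ (z,y)\in\delta)\}\in\mathcal{E}$ and $\varepsilon^{-1}=\{(y,x):(x,y)\in\varepsilon\}\in\mathcal{E}$; if $\varepsilon\in\mathcal{E}$ and $\Delta_X\subseteq\varepsilon'\subseteq\varepsilon$ then $\varepsilon'\in\mathcal{E}$; for any $x,y\in X$ there is $\varepsilon\in\mathcal{E}$ with $(x,y)\in\varepsilon$. The pair $(X,\mathcal{E})$ is called a ballean. Write $\varepsilon[x]=\{y\in X:(x,y)\in\varepsilon\}$ and $\varepsilon[A]=\bigcup_{a\in A}\varepsilon[a]$ for $A\subseteq X$. A subset $Y\subseteq X$ is bounded if $Y\subseteq\varepsilon[x]$ for some $x\in X$ and $\varepsilon\in\mathcal{E}$. A ballean $(X,\mathcal{E})$ is metrizable if there is a metric $d$ on $X$ with $\mathcal{E}=\mathcal{E}_d$, where $\mathcal{E}_d$ consists of all $\varepsilon\subseteq X\times X$ with $\Delta_X\subseteq\varepsilon\subseteq\{(x,y):d(x,y)<r\}$ for some real $r>0$. A subset $U\subseteq X$ is an asymptotic neighbourhood of $A\subseteq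 X$ if $\varepsilon[A]\setminus U$ is bounded for every $\varepsilon\in\mathcal{E}$. Subsets $A,B\subseteq X$ are asymptotically disjoint if $\varepsilon[A]\cap\varepsilon[B]$ is bounded for every $\varepsilon\in\mathcal{E}$, and asymptotically separated if they have disjoint asymptotic neighbourhoods. A ballean is normal if any two asymptotically disjoint subsets of it are asymptotically separated. A mapping $f:(X,\mathcal{E})\to(X',\mathcal{E}')$ between balleans is coarse if for every $\varepsilon\in\mathcal{E}$ there is $\varepsilon'\in\mathcal{E}'$ such that $f(\varepsilon[x])\subseteq\varepsilon'[f(x)]$ for every $x\in X$. For $Y\subseteq X$, the subballean on $Y$ is $(Y,\mathcal{E}_Y)$ with $\mathcal{E}_Y=\{\varepsilon\cap(Y\times Y):\varepsilon\in\mathcal{E}\}$. ''$(X,\mathcal{E})$ is a subballean of a ballean $(Z,\mathcal{F})$'', where $X\subseteq Z$, means $\mathcal{E}=\mathcal{F}_X$. A vector ideal on a real vector space $\mathcal{V}$ is a family $\mathcal{I}$ of subsets of $\mathcal{V}$ such that: (1) if $U,U'\in\mathcal{I}$ and $W\subseteq U$ then $U\cup U'\in\mathcal{I}$ and $W\in\mathcal{I}$; (2) if $U\in\mathcal{I}$ then $U+U\in\mathcal{I}$; (3) if $U\in\mathcal{I}$ and $\lambda>0$ then $[-\lambda,\lambda]U=\bigcup\{\lambda'U:\lambda'\in[-\lambda,\lambda]\}\in\mathcal{I}$; (4) $\bigcup\mathcal{I}=\mathcal{V}$. A vector ballean $(\mathcal{V},\mathcal{I})$ is a real vector space $\mathcal{V}$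 with a vector ideal $\mathcal{I}$, regarded as a ballean whose coarse structure consists of all $\varepsilon\subseteq\mathcal{V}\times\mathcal{V}$ with $\Delta_{\mathcal{V}}\subseteq\varepsilon\subseteq\{(x,y):x-y\in U\}$ for some $U\in\mathcal{I}$. $\mathbb{V}(X)$ denotes the real vector space with basis $X$. The free vector ideal $\mathcal{I}_{(X,\mathcal{E})}$ is the unique vector ideal on $\mathbb{V}(X)$ such that (i) $(X,\mathcal{E})$ is a subballean of $(\mathbb{V}(X),\mathcal{I}_{(X,\mathcal{E})})$, and (ii) for every vector ballean $(\mathcal{V},\mathcal{I})$, every coarse mapping $(X,\mathcal{E})\to(\mathcal{V},\mathcal{I})$ extends to a unique coarse linear mapping $(\mathbb{V}(X),\mathcal{I}_{(X,\mathcal{E})})\to(\mathcal{V},\mathcal{I})$. The free vector ballean over $(X,\mathcal{E})$ is $\mathbb{V}(X,\mathcal{E})=(\mathbb{V}(X),\mathcal{I}_{(X,\mathcal{E})})$. *)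

(* Defs.v *)
From HB Require Import structures.
From mathcomp Require Import all_boot all_order all_algebra.
From mathcomp Require Import finmap.
From mathcomp Require Import all_classical reals.
From mathcomp Require Import monalg.

Set Implicit Arguments.
Unset Strict Implicit.
Unset Printing Implicit Defensive.

Import Order.TTheory GRing.Theory Num.Theory.

Local Open Scope classical_set_scope.
Local Open Scope ring_scope.

Section Ballean.
Variable X : Type.
Implicit Types (e : set (X * X)) (A B U Y : set X) (x y : X).

(* The library's [B \; A] applies [A] first: [(e' \; e)] is the set of the
   [(x, y)] such that [e (x, z)] and [e' (z, y)] for some [z]. *)
Record coarse_structure (E : set (set (X * X))) : Prop := CoarseStructure {
  coarse_diag : forall e, E e -> diagonal `<=` e;
  coarse_comp : forall e e', E e -> E e' -> E (e' \; e)%relation;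
  coarse_inv : forall e, E e -> E (e^-1)%relation;
  coarse_sub : forall e e', E e -> diagonal `<=` e' -> e' `<=` e -> E e';
  coarse_connected : forall x y, exists e, E e /\ e (x, y) }.

Definition ent_nbhd e A : set X := \bigcup_(a in A) xsection e a.

Variable E : set (set (X * X)).

Definition coarsely_bounded Y := exists x e, E e /\ Y `<=` xsection e x.

Definition asymptotic_nbhd U A :=
  forall e, E e -> coarsely_bounded (ent_nbhd e A `\` U).

Definition asymptotically_disjoint A B :=
  forall e, E e -> coarsely_bounded (ent_nbhd e A `&` ent_nbhd e B).

Definition asymptotically_separated A B :=
  exists U V, [/\ asymptotic_nbhd U A, asymptotic_nbhd V B & U `&` V = set0].

Definition ballean_normal :=
  forall A B, asymptotically_disjoint A B -> asymptotically_separated A B.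

End Ballean.

Section Metrizable.
Variables (R : realType) (X : Type).

Record is_metric (d : X -> X -> R) : Prop := IsMetric {
  metric_ge0 : forall x y, 0 <= d x y;
  metric_eq0 : forall x y, d x y = 0 <-> x = y;
  metric_sym : forall x y, d x y = d y x;
  metric_triangle : forall x y z, d x z <= d x y + d y z }.

Definition metric_coarse (d : X -> X -> R) : set (set (X * X)) :=
  [set e | diagonal `<=` e /\
    exists2 r : R, 0 < r & e `<=` [set p | d p.1 p.2 < r]].

Definition ballean_metrizable (E : set (set (X * X))) :=
  exists2 d : X -> X -> R, is_metric d & E = metric_coarse d.

End Metrizable.

Definition coarse_map (X Y : Type) (E : set (set (X * X)))
    (F : set (set (Y * Y))) (f : X -> Y) :=
  forall e, E e -> exists2 e', F e' &
    forall x, f @` xsection e x `<=` xsection e' (f x).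

(* [E] is the structure induced on [X] by [F], where [X] is regarded as a
   subset of [Y] through the injection [i]. *)
Definition subballean_via (X Y : Type) (i : X -> Y)
    (E : set (set (X * X))) (F : set (set (Y * Y))) :=
  E = [set [set p | e (i p.1, i p.2)] | e in F].

Section VectorBallean.
Variables (R : realType) (V : lmodType R).

Record vector_ideal (I : set (set V)) : Prop := VectorIdeal {
  videal_set : forall U U' W, I U -> I U' -> W `<=` U -> I (U `|` U') /\ I W;
  videal_add : forall U, I U -> I [set u + v | u in U & v in U];
  videal_scale : forall U (l : R), I U -> 0 < l ->
    I [set m *: u | m in [set m | - l <= m <= l] & u in U];
  videal_cover : \bigcup_(U in I) U = [set: V] }.

Definition videal_coarse (I : set (set V)) : set (set (V * V)) :=
  [set e | diagonal `<=` e /\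
    exists2 U, I U & e `<=` [set p | U (p.1 - p.2)]].

End VectorBallean.

Section FreeVectorBallean.
Variables (R : realType) (X : choiceType).

(* [{malg R[X]}] is used only as the R-module of finitely supported functions
   from [X] to [R], with basis [<< x >>] for [x : X]. *)
Record free_vector_ideal (E : set (set (X * X)))
    (I : set (set {malg R[X]})) : Prop := FreeVectorIdeal {
  fvi_ideal : vector_ideal I;
  fvi_sub : subballean_via (fun x => << x >>) E (videal_coarse I);
  fvi_univ : forall (W : lmodType R) (J : set (set W)) (f : X -> W),
    vector_ideal J -> coarse_map E (videal_coarse J) f ->
    exists! g : {malg R[X]} -> W,
      [/\ linear g, coarse_map (videal_coarse I) (videal_coarse J) g
        & forall x, g << x >> = f x] }.

End FreeVectorBallean.

(* Main.v *)
Require Import Defs.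
From HB Require Import structures.
From mathcomp Require Import all_boot all_order all_algebra.
From mathcomp Require Import finmap.
From mathcomp Require Import all_classical reals.
From mathcomp Require Import monalg.
From mathcomp Require Import lra.

(** A vector ballean is metrizable as soon as its ideal [I] is countably
    generated: choose [U_0 = {0}] and symmetric [U_n] in [I], cofinal, with
    [U_n + U_n <= U_(n+1)], and let [d x y] be the least [n] such that
    [x - y] lies in [U_n].

    The sum of coefficients [s] is a linear functional bounded on the members
    of [I], by the universal property applied to the constant map [1].  Fix a
    basis vector [x0], so that [s x0 = 1].  The hyperplane [ker s] and the line
    spanned by [x0] are asymptotically disjoint; let [P] and [Q] be disjoint
    asymptotic neighbourhoods of them.  The sets
    [W_n = {v in ker s | v + n x0 notin P}] belong to [I].  If [U] in [I] lies
    in [ker s], then [U + n x0] is contained in [Q] for [n] large, so that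
    [U] is contained in [W_n].  Hence [I] is countably generated. *)

Set Implicit Arguments.
Unset Strict Implicit.
Unset Printing Implicit Defensive.

Import Order.TTheory GRing.Theory Num.Theory.

Local Open Scope classical_set_scope.

(** * Normality of metrizable balleans *)

Section MetrizableNormal.
Local Open Scope ring_scope.
Variables (R : realType) (X : Type).

Lemma metrizable_normal (E : set (set (X * X))) :
  ballean_metrizable R E -> ballean_normal E.
Proof.
case=> d [d_ge0 d0 d_sym d_tri] -> A B AB.
(* A single [a] must beat every [b], which avoids distances to sets; the strict inequality makes
   [nearer A B] and [nearer B A] disjoint. *)
pose nearer C D := [set x | exists2 a, C a & forall b, D b -> d x a < d x b].
have nearerP C D : (forall r, 0 < r -> coarsely_bounded (metric_coarse d)
      ([set x | exists2 a, C a & d a x < r] `&`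
       [set x | exists2 a, D a & d a x < r])) ->
    asymptotic_nbhd (metric_coarse d) (nearer C D) C.
  move=> CD e [_ [r r0 er]]; have [x [e' [Ee' sub]]] := CD r r0.
  (* A point within [r] of [C] but outside [nearer C D] is also within [r] of [D]. *)
  exists x, e'; split=> // y [[a Ca /xsectionP eay] Ny]; apply: sub.
  have ay : d a y < r by exact: er eay.
  split; first by exists a.
  apply: contrapT => nD; apply: Ny; exists a => // b Db.
  rewrite [d y a]d_sym [d y b]d_sym; apply: (lt_le_trans ay).
  by rewrite leNgt; apply/negP => lt_r; apply: nD; exists b.
have ABr r : 0 < r -> coarsely_bounded (metric_coarse d)
    ([set x | exists2 a, A a & d a x < r] `&`
     [set x | exists2 a, B a & d a x < r]).
  move=> r0; have /AB[x [e [Ee sub]]] :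
      metric_coarse d [set p | d p.1 p.2 < r].
    split; last by exists r.
    by move=> [x y]; rewrite /diagonal /= => ->; rewrite (d0 y y).2.
  exists x, e; split=> // y [[a Aa ay] [b Bb yb]]; apply: sub.
  by split; [exists a => //; apply/xsectionP | exists b => //; apply/xsectionP].
exists (nearer A B), (nearer B A); split.
- exact: nearerP.
- by apply: nearerP => r r0; rewrite setIC; exact: ABr.
- apply/seteqP; split=> // x [[a Aa ltA] [b Bb ltB]].
  by have := lt_trans (ltA b Bb) (ltB a Aa); rewrite ltxx.
Qed.

End MetrizableNormal.

(** * Vector ideals, their entourages and their bounded sets *)

Section VectorIdeal.
Local Open Scope ring_scope.
Variables (R : realType) (V : lmodType R) (I : set (set V)).
Hypothesis idI : vector_ideal I.
Implicit Types U W : set V.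

Lemma videal_sub U W : I U -> W `<=` U -> I W.
Proof. by move=> IU WU; have [] := videal_set idI IU IU WU. Qed.

Lemma videal_setU U W : I U -> I W -> I (U `|` W).
Proof. by move=> IU IW; have [] := videal_set idI IU IW (@subset_refl _ U). Qed.

Lemma videal_addW U W : I U -> I W -> I [set u + v | u in U & v in W].
Proof.
move=> IU IW; apply: videal_sub (videal_add idI (videal_setU IU IW)) _.
by move=> _ [u Uu [v Wv <-]]; exists u; [left | exists v; first right].
Qed.

Lemma videal_set1 v : I [set v].
Proof.
have : [set: V] v by [].
rewrite -(videal_cover idI) => -[U IU Uv].
by apply: videal_sub IU _ => _ ->.
Qed.

Lemma videal_opp U : I U -> I [set - u | u in U].
Proof.
move=> IU; apply: videal_sub (videal_scale idI IU ltr01) _ => _ [u Uu <-].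
by exists (-1); [rewrite /= lexx; lra | exists u => //; rewrite scaleN1r].
Qed.

Lemma videal_segment (l : R) v : I [set m *: v | m in [set m | `|m| <= l]].
Proof.
have l0 : 0 < `|l| + 1 by rewrite ltr_wpDl.
apply: videal_sub (videal_scale idI (videal_set1 v) l0) _ => _ [m /= ml <-].
exists m; last by exists v.
rewrite /= -ler_norml; apply: (le_trans ml).
by rewrite (le_trans (ler_norm l))// lerDl.
Qed.

(** The diagonal is added because [U] may miss 0. The section at [x] is [x - U] together with [x],
    whence the negated sets in later uses. *)
Definition ideal_entourage U : set (V * V) :=
  [set p | p.1 = p.2 \/ U (p.1 - p.2)].

Lemma ideal_entourageP U : I U -> videal_coarse I (ideal_entourage U).
Proof.
move=> IU; split; first by move=> [x y]; rewrite /diagonal /= => ->; left.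
exists ([set 0] `|` U); first exact: videal_setU (videal_set1 0) IU.
by move=> [x y] [/= ->|]; [left; rewrite subrr | right].
Qed.

(** If the differences lie in [W], the section at [x] lies in [x - W]; conversely, a member of [I]
    lies in a section at 0. *)
Lemma videal_boundedP U : coarsely_bounded (videal_coarse I) U <-> I U.
Proof.
split=> [[x [e [[_ [W IW eW]] Ue]]]|IU].
  apply: videal_sub (videal_addW (videal_set1 x) (videal_opp IW)) _.
  move=> u /Ue /xsectionP /eW /= Wxu; exists x => //.
  exists (- (x - u)); first by exists (x - u).
  by rewrite opprB addrC subrK.
exists 0, (ideal_entourage [set - u | u in U]); split.
  exact/ideal_entourageP/videal_opp.
by move=> u Uu; apply/xsectionP; right; rewrite /= sub0r; exists u.
Qed.

Lemma videal_nbhd U A : I U ->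
  ent_nbhd (ideal_entourage [set - u | u in U]) A =
  A `|` [set a + u | a in A & u in U].
Proof.
move=> IU; apply/seteqP; split=> [y [a Aa /xsectionP[/= <-|[u Uu /= uE]]]|y].
- by left.
- by right; exists a => //; exists u => //; rewrite -[u]opprK uE opprB addrC subrK.
move=> [Ay|[a Aa [u Uu <-]]].
  by exists y => //; apply/xsectionP; left.
exists a => //; apply/xsectionP; right; exists u => //=.
by rewrite opprD addrA subrr sub0r.
Qed.

Definition videal_basis (W : nat -> set V) :=
  (forall n, I (W n)) /\ (forall U, I U -> exists n, U `<=` W n).

(** * The integer-valued metric of a countably generated ideal *)

Section Metric.
Variable W : nat -> set V.
Hypothesis baseW : videal_basis W.

(** [W n'] gives cofinality, the sum set the triangle inequality, and the factors from [-1, 1]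
    symmetry. Starting from {0} makes the gauge vanish only at 0. *)
Fixpoint gauge_ball n : set V :=
  if n is n'.+1 then
    [set m *: u | m in [set m : R | - 1 <= m <= 1] &
      u in W n' `|` [set u + v | u in gauge_ball n' & v in gauge_ball n']]
  else [set 0].

Lemma gauge_ball_ideal n : I (gauge_ball n).
Proof.
elim: n => [|n IHn] /=; first exact: videal_set1.
by apply: (videal_scale idI) => //; apply: videal_setU;
  [exact: baseW.1 | exact: videal_add idI _ _].
Qed.

Lemma gauge_ball0 n : gauge_ball n 0.
Proof.
elim: n => //= n IHn; exists 1; first by rewrite /= lexx; lra.
exists 0; last by rewrite scaler0.
by right; exists 0 => //; exists 0 => //; rewrite addr0.
Qed.

Lemma gauge_ballN n u : gauge_ball n u -> gauge_ball n (- u).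
Proof.
case: n => [|n] /=; first by move=> ->; rewrite oppr0.
move=> [m /= m1 [v Wv <-]]; exists (- m); last by exists v; rewrite // scaleNr.
by rewrite /=; lra.
Qed.

Lemma gauge_ballD n u v : gauge_ball n u -> gauge_ball n v ->
  gauge_ball n.+1 (u + v).
Proof.
move=> nu nv; exists 1; first by rewrite /= lexx; lra.
by exists (u + v); [right; exists u => //; exists v | rewrite scale1r].
Qed.

Lemma gauge_ball_le m n : (m <= n)%N -> gauge_ball m `<=` gauge_ball n.
Proof.
elim: n => [|n IHn]; first by rewrite leqn0 => /eqP ->.
rewrite leq_eqVlt => /predU1P[-> //|]; rewrite ltnS => /IHn mn u /mn nu.
by rewrite -[u]addr0; apply: gauge_ballD => //; exact: gauge_ball0.
Qed.

Lemma gauge_ball_cofinal U : I U -> exists n, U `<=` gauge_ball n.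
Proof.
move=> /baseW.2[n UW]; exists n.+1 => u Uu; exists 1.
  by rewrite /= lexx; lra.
by exists u; [left; exact: UW | rewrite scale1r].
Qed.

Lemma gauge_subproof v : exists n, `[< gauge_ball n v >].
Proof.
have [n vn] := gauge_ball_cofinal (videal_set1 v).
by exists n; apply/asboolP/vn.
Qed.

Definition gauge v : nat := ex_minn (gauge_subproof v).

Lemma gaugeP v n : (gauge v <= n)%N <-> gauge_ball n v.
Proof.
rewrite /gauge; case: ex_minnP => m /asboolP mv min_m; split=> [mn|nv].
  exact: gauge_ball_le mn _ mv.
by apply/min_m/asboolP.
Qed.

Lemma gauge_eq0 v : gauge v = 0%N <-> v = 0.
Proof.
split=> [v0|->]; first by have /gaugeP : (gauge v <= 0)%N by rewrite v0.
by apply/eqP; rewrite -leqn0; apply/gaugeP.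
Qed.

Lemma gaugeN v : gauge (- v) = gauge v.
Proof.
apply/eqP; rewrite eqn_leq; apply/andP; split.
  by apply/gaugeP/gauge_ballN/gaugeP.
by apply/gaugeP; rewrite -[v in gauge_ball _ v]opprK; apply/gauge_ballN/gaugeP.
Qed.

(** When both gauges are positive, their maximum plus one is at most their sum; a zero gauge means a
    zero vector. *)
Lemma gaugeD u v : (gauge (u + v) <= gauge u + gauge v)%N.
Proof.
have [/gauge_eq0 ->|u0] := posnP (gauge u); first by rewrite add0r leq_addl.
have [/gauge_eq0 ->|v0] := posnP (gauge v); first by rewrite addr0 leq_addr.
apply: (@leq_trans (maxn (gauge u) (gauge v)).+1).
  by apply/gaugeP/gauge_ballD; apply/gaugeP; rewrite (leq_maxl, leq_maxr).
by rewrite gtn_max -[X in (X < _)%N]addn0 ltn_add2l v0 -[X in (X < _)%N]add0n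
  ltn_add2r.
Qed.

Lemma gauge_metrizable : ballean_metrizable R (videal_coarse I).
Proof.
exists (fun x y => (gauge (x - y))%:R).
  split=> [x y|x y|x y|x y z]; first exact: ler0n.
  - split=> [/eqP|->]; last by rewrite subrr (gauge_eq0 0).2.
    by rewrite pnatr_eq0 => /eqP/gauge_eq0/eqP; rewrite subr_eq0 => /eqP.
  - by rewrite -opprB gaugeN.
  - by rewrite -natrD ler_nat; apply: leq_trans (gaugeD _ _); rewrite addrA subrK.
apply/seteqP; split=> e [De].
  move=> [U /gauge_ball_cofinal[n Un] eU]; split=> //.
  exists n.+1%:R; rewrite ?ltr0n// => p /eU/Un/gaugeP.
  by rewrite /= ltr_nat ltnS.
(* Gauges are integers, so one below [r] is at most [Num.truncn r]. *)
move=> [r r0 er]; split=> //; exists (gauge_ball (Num.truncn r)).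
  exact: gauge_ball_ideal.
move=> p /er /= pr; apply/gaugeP.
by rewrite truncn_ge_nat ?ltW.
Qed.

End Metric.

(** * From normality to a countable base of the ideal *)

(* [s] splits off the line spanned by [x0] as a coarse direct factor. *)
Lemma normal_videal_basis (s : {linear V -> R^o}) (x0 : V) :
  s x0 = 1 -> (forall U, I U -> exists M, forall u, U u -> `|s u| <= M) ->
  ballean_normal (videal_coarse I) -> exists W : nat -> set V, videal_basis W.
Proof.
move=> sx0 bnd normI.
pose H := [set v | s v = 0]; pose L := [set r *: x0 | r in [set: R]].
have sZ r : s (r *: x0) = r by rewrite linearZ /= sx0 /GRing.scale /= mulr1.
have [P [Q [PH QL PQ]]] : asymptotically_separated (videal_coarse I) H L.
  (* If [a - y] and [r *: x0 - y] lie in [U] with [s a = 0], then [s y] and [r - s y] are bounded by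
     [M], so [r] is bounded by [M + M] and [y] lies in a segment minus [U]. *)
  apply: normI => e [_ [U IU eU]]; apply/videal_boundedP.
  have [M sM] := bnd _ IU.
  apply: videal_sub (videal_addW (videal_segment (M + M) x0)
    (videal_opp IU)) _ => y [[a Ha /xsectionP/eU/= Ua]].
  move=> [_ [r _ <-] /xsectionP/eU/= Ur].
  exists (r *: x0); last by exists (- (r *: x0 - y));
    [exists (r *: x0 - y) | rewrite opprB addrC subrK].
  exists r => //=; have := sM _ Ua; have := sM _ Ur.
  rewrite !linearB /= sZ Ha sub0r normrN => ry y_M.
  by rewrite -[r](subrK (s y)) (le_trans (ler_normD _ _))// lerD.
pose W n := [set v | H v /\ ~ P (v + n%:R *: x0)].
have IW n : I (W n).
  have IUn : I [set n%:R *: x0] by exact: videal_set1.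
  (* The translate of [W n] by [n%:R *: x0] lies in a neighbourhood of [H] and misses [P], so it is
     bounded. *)
  have /videal_boundedP IP := PH _ (ideal_entourageP (videal_opp IUn)).
  apply: videal_sub (videal_addW IP (videal_set1 (- (n%:R *: x0)))) _.
  move=> v [Hv Pv]; exists (v + n%:R *: x0); last first.
    by exists (- (n%:R *: x0)); rewrite ?addrK.
  by rewrite videal_nbhd//; split=> //; right; exists v => //; exists (n%:R *: x0).
have WU U : I U -> U `<=` H ->
    exists N, forall n, (N <= n)%N -> U `<=` W n.
  (* On the part of [L + U] outside [Q], [s] is bounded by [M]. Since [s] equals [n] on [U + n x0],
     this translate lies in [Q] once [n] exceeds [M]. *)
  move=> IU UH; have /videal_boundedP IQ := QL _ (ideal_entourageP (videal_opp IU)).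
  have [M sM] := bnd _ IQ; exists (Num.truncn M).+1 => n Mn u Uu.
  split; first exact: UH.
  move=> Pu; have /sM : (ent_nbhd (ideal_entourage [set - u | u in U]) L `\` Q)
      (u + n%:R *: x0).
    rewrite videal_nbhd//; split.
      right; exists (n%:R *: x0); first by exists n%:R.
      by exists u; rewrite // addrC.
    by move=> Qu; have : (P `&` Q) (u + n%:R *: x0) by []; rewrite PQ.
  rewrite linearD /= sZ (UH _ Uu) add0r ger0_norm ?ler0n// leNgt => /negP; apply.
  apply: lt_le_trans (truncnS_gt M) _.
  by rewrite ler_nat.
exists (fun n => [set w + v | w in W n &
    v in [set m *: x0 | m in [set m : R | `|m| <= n%:R]]]); split=> [n|U IU].
  exact: videal_addW (IW n) (videal_segment _ _).
have [M sM] := bnd _ IU.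
pose U0 := [set u - s u *: x0 | u in U].
have U0H : U0 `<=` H.
  by move=> _ [u Uu <-]; rewrite /H /= linearB /= sZ subrr.
have IU0 : I U0.
  apply: videal_sub (videal_addW IU (videal_segment M x0)) _.
  move=> _ [u Uu <-]; exists u => //; exists (- s u *: x0).
    by exists (- s u); rewrite //= normrN sM.
  by rewrite scaleNr.
have [N WN] := WU _ IU0 U0H.
(* [WN] covers every index from [N] on, so one index serves both the hyperplane part and the segment
   part of [u]. *)
exists (maxn N (Num.truncn M).+1) => u Uu.
exists (u - s u *: x0).
  by apply: (WN _ (leq_maxl _ _)); exists u.
exists (s u *: x0); last by rewrite subrK.
exists (s u) => //=; apply: (le_trans (sM _ Uu)); apply: ltW.
by apply: (lt_le_trans (truncnS_gt M)); rewrite ler_nat leq_maxr.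
Qed.

End VectorIdeal.

(** * The real line with its bounded sets, as target of the coefficient sum *)

Section BoundedIdeal.
Local Open Scope ring_scope.
Variable R : realType.

Definition bounded_ideal : set (set R^o) :=
  [set U | exists M : R, forall u, U u -> `|u| <= M].

Lemma bounded_ideal_vector_ideal : vector_ideal bounded_ideal.
Proof.
split.
- move=> U U' W [M UM] [M' UM'] WU; split; last by exists M => u /WU/UM.
  exists (Num.max M M') => u [/UM|/UM'] uM;
    by rewrite le_max uM ?orbT.
- move=> U [M UM]; exists (M + M) => _ [u /UM uM [v /UM vM <-]].
  by rewrite (le_trans (ler_normD _ _))// lerD.
- move=> U l [M UM] l0; exists (l * M) => _ [m /= ml [u /UM uM <-]].
  by rewrite /GRing.scale /= normrM ler_pM// ler_norml.
- apply/seteqP; split=> // u _; exists [set u] => //.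
  by exists `|u| => _ ->.
Qed.

End BoundedIdeal.

(** * The coefficient sum on the free vector ballean *)

Section FreeVectorIdeal.
Local Open Scope ring_scope.
Variables (R : realType) (X : choiceType) (E : set (set (X * X))).
Variable I : set (set {malg R[X]}).
Hypothesis freeI : free_vector_ideal E I.

Lemma free_videal_sum : exists s : {linear {malg R[X]} -> R^o},
  (forall x, s << x >> = 1) /\
  (forall U, I U -> exists M, forall u, U u -> `|s u| <= M).
Proof.
have idI := fvi_ideal freeI; have idJ := bounded_ideal_vector_ideal R.
have c1 : coarse_map E (videal_coarse (@bounded_ideal R))
    (fun=> 1 : R^o).
  (* A constant map sends each section into one point, so the diagonal, given by {0}, suffices. *)
  move=> e _; exists (ideal_entourage [set 0]).
    exact/(ideal_entourageP idJ)/(videal_set1 idJ).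
  by move=> x _ [y _ <-]; apply/xsectionP; left.
have [g [[lin_g coarse_g g1] _]] := fvi_univ freeI idJ c1.
pose gL := GRing.isLinear.Build R _ _ _ g lin_g.
pose s : {linear {malg R[X]} -> R^o} := HB.pack g gL.
exists s; split=> // U IU.
have [e' [_ [W [M WM] e'W]] sub] := coarse_g _ (ideal_entourageP idI IU).
exists M => u Uu; apply: WM.
(* Coarseness is applied at 0: [- u] lies in the section there, and [g 0 - g (- u)] is [g u]. *)
have /xsectionP/e'W : xsection e' (g 0) (g (- u)).
  apply: sub; exists (- u) => //; apply/xsectionP; right.
  by rewrite /= opprK add0r.
by rewrite /= -[g 0]/(s 0) -[g (- u)]/(s (- u)) linear0 linearN opprK add0r.
Qed.

End FreeVectorIdeal.

Theorem theorem3 (R : realType) (X : choiceType) (E : set (set (X * X)))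
    (I : set (set {malg R[X]})) :
  coarse_structure E -> free_vector_ideal E I ->
  ballean_normal (videal_coarse I) <-> ballean_metrizable R (videal_coarse I).
Proof.
move=> _ freeI; have idI := fvi_ideal freeI; split; last exact: metrizable_normal.
move=> normI; suff [W baseW] : exists W, videal_basis I W.
  exact: gauge_metrizable baseW.
have [[x0]|X0] := pselect (inhabited X).
  have [s [s1 bnd]] := free_videal_sum freeI.
  exact: normal_videal_basis (s1 x0) bnd normI.
(* Over an empty basis the space is {0}, itself a member of [I]. *)
exists (fun=> [set: {malg R[X]}]); split=> [_|U IU]; last by exists 0%N.
apply: (videal_sub idI (videal_set1 idI 0%R)) => u _.
by apply/malgP => x; case: X0.
Qed.
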